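(* Consider the trilinear operations $\omega_1(x,y,z) = x[y,z]$ (anti-Jordan family, $q=-1$), $\omega_2(x,y,z) = x(y\circ z)+z(x\circ y)+(z\circ x)y$ (Jordan family, $q=\tfrac12$) and $\omega_3(x,y,z) = xyz+zyx$ (Jordan family, $q=\infty$), where $[u,v]=uv-vu$ and $u\circ v=\tfrac12(uv+vu)$. Then $U(A^{\omega_1})\cong U(A^{\omega_2})\cong U(A^{\omega_3})$ as unital associative algebras.
   Context: $\mathbb{F}$ is a field of characteristic $0$. $A$ is the 2-dimensional space of $2\times 2$ matrices over $\mathbb{F}$ with zero diagonal, with basis $e_1 = \begin{bmatrix} 0&1\\0&0\end{bmatrix}$, $e_2 = \begin{bmatrix} 0&0\\1&0\end{bmatrix}$; it is closed under triple products $xyz$ of matrices. For a trilinear operation $\omega(x,y,z)$ (a fixed rational linear combination of the six products of $x,y,z$ in all orders), $A^\omega$ denotes the space $A$ with the trilinear operation $\omega$ computed using matrix multiplication. Let $\mathbb{F}\langle a,b\rangle$ be the free unital associative algebra and $\phi\colon A \to \mathbb{F}\langle a,b\rangle$ the linear map with $\phi(e_1)=a$, $\phi(e_2)=b$. The universal associative envelope is $U(A^\omega) = \mathbb{F}\langle a,b\rangle / I$, where $I$ is the two-sided ideal generated by the elements $\omega(\phi(x),\phi(y),\phi(z)) - \phi(\omega(x,y,z))$ for $x,y,z\in\{e_1,e_2\}$. *)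

(* Defs.v *)
From HB Require Import structures.
From mathcomp Require Import all_boot all_algebra.
From mathcomp Require Import boolp monalg.

Set Implicit Arguments.
Unset Strict Implicit.
Unset Printing Implicit Defensive.

Import GRing.Theory.
Local Open Scope ring_scope.
Local Open Scope quotient_scope.

(* [idealr] covers proper ideals stable by multiplication on the left. *)
HB.mixin Record isRightIdeal (R : nzRingType) (S : R -> bool) := {
  ideal_mulr_subproof : forall a, {in S, forall u, u * a \in S}
}.

#[short(type="ideal2")]
HB.structure Definition Ideal2 (R : nzRingType) :=
  {S of Idealr R S & isRightIdeal R S}.

Lemma ideal2Ml (R : nzRingType) (I : ideal2 R) a u :
  u \in (I : pred R) -> a * u \in (I : pred R).
Proof. exact: idealMr. Qed.

Lemma ideal2Mr (R : nzRingType) (I : ideal2 R) a u :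
  u \in (I : pred R) -> u * a \in (I : pred R).
Proof. exact: ideal_mulr_subproof. Qed.

Definition alg_quot (R : nzRingType) (I : ideal2 R) : Type := {ideal_quot I}.

Section AlgQuotient.
Variables (F : fieldType) (B : algType F) (I : ideal2 B).

Local Notation Q := (@alg_quot B I).
Local Notation equivI := (Quotient.equiv I).

HB.instance Definition _ := ZmodQuotient.on Q.

Lemma pi_alg_quotP (x y : B) : \pi_Q x = \pi_Q y <-> x - y \in I.
Proof.
rewrite -[x - y \in I]/(equivI x y); split=> [/eqP|h].
  by rewrite piE.
by apply/eqP; rewrite piE.
Qed.

Definition alg_quot_one : Q := \pi_Q 1.
Definition alg_quot_mul : Q -> Q -> Q := lift_op2 Q *%R.
Definition alg_quot_scale (c : F) : Q -> Q := lift_op1 Q ( *:%R c).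

Lemma alg_quotW (P : Q -> Prop) : (forall x : B, P (\pi_Q x)) -> forall x, P x.
Proof. by move=> h x; rewrite -[x]reprK. Qed.

Lemma pi_alg_mul x y : alg_quot_mul (\pi_Q x) (\pi_Q y) = \pi_Q (x * y).
Proof.
have hr u : repr (\pi_Q u) - u \in I by apply/pi_alg_quotP; rewrite reprK.
unlock alg_quot_mul; apply/pi_alg_quotP.
set x' := repr _; set y' := repr _.
have -> : x' * y' - x * y = (x' - x) * y' + x * (y' - y).
  by rewrite mulrBl mulrBr addrA subrK.
by apply: rpredD; [apply: ideal2Mr | apply: ideal2Ml]; exact: hr.
Qed.

Lemma pi_alg_scale c x : alg_quot_scale c (\pi_Q x) = \pi_Q (c *: x).
Proof.
unlock alg_quot_scale; apply/pi_alg_quotP; rewrite -scalerBr -[_ - _]mul1r scalerAl.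
apply: ideal2Ml.
by apply/pi_alg_quotP; rewrite reprK.
Qed.

Let piD x y : \pi_Q (x + y) = \pi_Q x + \pi_Q y.
Proof. exact: pi_addr. Qed.

Lemma alg_quot_mulA : associative alg_quot_mul.
Proof.
move=> x y z; elim/alg_quotW: x => x; elim/alg_quotW: y => y.
by elim/alg_quotW: z => z; rewrite !pi_alg_mul mulrA.
Qed.

Lemma alg_quot_mul1 : left_id alg_quot_one alg_quot_mul.
Proof. by move=> x; elim/alg_quotW: x => x; rewrite pi_alg_mul mul1r. Qed.

Lemma alg_quot_1mul : right_id alg_quot_one alg_quot_mul.
Proof. by move=> x; elim/alg_quotW: x => x; rewrite pi_alg_mul mulr1. Qed.

Lemma alg_quot_mulDl : left_distributive alg_quot_mul +%R.
Proof.
move=> x y z; elim/alg_quotW: x => x; elim/alg_quotW: y => y; elim/alg_quotW: z => z.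
by rewrite -piD !pi_alg_mul mulrDl piD.
Qed.

Lemma alg_quot_mulDr : right_distributive alg_quot_mul +%R.
Proof.
move=> x y z; elim/alg_quotW: x => x; elim/alg_quotW: y => y; elim/alg_quotW: z => z.
by rewrite -piD !pi_alg_mul mulrDr piD.
Qed.

Lemma alg_quot_1neq0 : alg_quot_one != 0.
Proof.
apply/eqP; rewrite -[0](@pi_zeror _ _ _ _ _ Q) => /pi_alg_quotP.
by rewrite subr0 idealr1.
Qed.

HB.instance Definition _ := GRing.Zmodule_isNzRing.Build Q
  alg_quot_mulA alg_quot_mul1 alg_quot_1mul alg_quot_mulDl alg_quot_mulDr
  alg_quot_1neq0.

Lemma alg_quot_scaleA a b (v : Q) :
  alg_quot_scale a (alg_quot_scale b v) = alg_quot_scale (a * b) v.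
Proof. by elim/alg_quotW: v => v; rewrite !pi_alg_scale scalerA. Qed.

Lemma alg_quot_scale1 : left_id 1 alg_quot_scale.
Proof. by move=> v; elim/alg_quotW: v => v; rewrite pi_alg_scale scale1r. Qed.

Lemma alg_quot_scaleDr : right_distributive alg_quot_scale +%R.
Proof.
move=> a u v; elim/alg_quotW: u => u; elim/alg_quotW: v => v.
by rewrite -piD !pi_alg_scale scalerDr piD.
Qed.

Lemma alg_quot_scaleDl v :
  {morph alg_quot_scale^~ v : a b / a + b}.
Proof.
by move=> a b; elim/alg_quotW: v => v; rewrite !pi_alg_scale scalerDl piD.
Qed.

HB.instance Definition _ := GRing.Zmodule_isLmodule.Build F Q
  alg_quot_scaleA alg_quot_scale1 alg_quot_scaleDr alg_quot_scaleDl.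

Lemma alg_quot_scaleAl (a : F) (u v : Q) : a *: (u * v) = (a *: u) * v.
Proof.
elim/alg_quotW: u => u; elim/alg_quotW: v => v.
change (alg_quot_scale a (alg_quot_mul (\pi_Q u) (\pi_Q v))
  = alg_quot_mul (alg_quot_scale a (\pi_Q u)) (\pi_Q v)).
by rewrite pi_alg_mul !pi_alg_scale pi_alg_mul scalerAl.
Qed.

HB.instance Definition _ := GRing.Lmodule_isLalgebra.Build F Q alg_quot_scaleAl.

Lemma alg_quot_scaleAr (a : F) (u v : Q) : a *: (u * v) = u * (a *: v).
Proof.
elim/alg_quotW: u => u; elim/alg_quotW: v => v.
change (alg_quot_scale a (alg_quot_mul (\pi_Q u) (\pi_Q v))
  = alg_quot_mul (\pi_Q u) (alg_quot_scale a (\pi_Q v))).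
by rewrite pi_alg_mul !pi_alg_scale pi_alg_mul scalerAr.
Qed.

HB.instance Definition _ := GRing.Lalgebra_isAlgebra.Build F Q alg_quot_scaleAr.

End AlgQuotient.

Section GeneratedIdeal.
Variable R : nzRingType.

Definition two_sided_ideal (J : R -> Prop) : Prop :=
  [/\ J 0, (forall u v, J u -> J v -> J (u - v)) &
      forall a u, J u -> J (a * u) /\ J (u * a)].

Definition ideal_gen (G : R -> Prop) : R -> bool := fun x =>
  `[< forall J : R -> Prop, two_sided_ideal J -> (forall g, G g -> J g) -> J x >].

End GeneratedIdeal.

(* Noncommutative polynomials: the algebra of the free monoid on two letters;
   the letters are the booleans. *)
Definition free2 (F : fieldType) : Type := {malg F[{fmonom bool}]}.

Section Free2.
Variable F : fieldType.

HB.instance Definition _ := GRing.Lalgebra.on (free2 F).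

Lemma free2_scaleAr (c : F) (x y : free2 F) : c *: (x * y) = x * (c *: y).
Proof.
have comm_c (u : free2 F) : u * c%:MP = c *: u.
  rewrite [LHS]fgmulgU malgZ_def /fgscale; apply: eq_bigr => k _.
  by rewrite mulm1 mulrC.
by rewrite -(comm_c (x * y)) -mulrA comm_c.
Qed.

HB.instance Definition _ := GRing.Lalgebra_isAlgebra.Build F (free2 F)
  free2_scaleAr.

Definition gen_a : free2 F := << fmu false >>.
Definition gen_b : free2 F := << fmu true >>.

Definition const_term (g : free2 F) : F :=
  mcoeff (@mone {fmonom bool}) (g : {malg F[{fmonom bool}]}).

Fact const_term_is_zmod_morphism : zmod_morphism const_term.
Proof. exact: mcoeffB. Qed.
Fact const_term_is_monoid_morphism : monoid_morphism const_term.
Proof. by split; [exact: rmorph1 | exact: rmorphM]. Qed.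
Fact const_term_is_scalable : scalable_for *%R const_term.
Proof. by move=> c u; exact: mcoeffZ. Qed.

HB.instance Definition _ := GRing.isZmodMorphism.Build (free2 F) F const_term
  const_term_is_zmod_morphism.
HB.instance Definition _ := GRing.isMonoidMorphism.Build (free2 F) F const_term
  const_term_is_monoid_morphism.
HB.instance Definition _ := GRing.isScalable.Build F (free2 F) F *%R const_term
  const_term_is_scalable.

Lemma const_term_a : const_term gen_a = 0.
Proof. by rewrite /const_term mcoeffU fm1_eq1. Qed.
Lemma const_term_b : const_term gen_b = 0.
Proof. by rewrite /const_term mcoeffU fm1_eq1. Qed.

End Free2.

Section ZeroDiag.
Variable F : fieldType.

Definition zero_diag : {pred 'M[F]_2} := fun M => (M 0 0 == 0) && (M 1 1 == 0).

Fact zero_diag_submod_closed : submod_closed zero_diag.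
Proof.
split=> [|c M N]; first by rewrite unfold_in !mxE eqxx.
rewrite !unfold_in; move=> /andP[/eqP M0 /eqP M1] /andP[/eqP N0 /eqP N1].
by rewrite !mxE M0 M1 N0 N1 mulr0 addr0 eqxx.
Qed.

HB.instance Definition _ :=
  GRing.isSubmodClosed.Build F 'M[F]_2 zero_diag zero_diag_submod_closed.

Record zdmx : predArgType :=
  ZDMx { zdmx_val :> 'M[F]_2; _ : zdmx_val \in zero_diag }.

HB.instance Definition _ := [isSub for zdmx_val].
HB.instance Definition _ := [Choice of zdmx by <:].
HB.instance Definition _ := [SubChoice_isSubLmodule of zdmx by <:].

Fact zero_diag_e1 : delta_mx 0 1 \in zero_diag.
Proof. by rewrite unfold_in !mxE /= eqxx. Qed.
Fact zero_diag_e2 : delta_mx 1 0 \in zero_diag.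
Proof. by rewrite unfold_in !mxE /= eqxx. Qed.

Definition e1 : zdmx := ZDMx zero_diag_e1.
Definition e2 : zdmx := ZDMx zero_diag_e2.

Lemma zdmxE (x : zdmx) : x = (x : 'M_2) 0 1 *: e1 + (x : 'M_2) 1 0 *: e2.
Proof.
apply: val_inj; apply/matrixP=> i j; rewrite !mxE.
case: x => M /=; rewrite unfold_in => /andP[/eqP M0 /eqP M1].
have ord2 (k : 'I_2) : k = 0 \/ k = 1.
  by case: k => [[|[|k]] hk]; [left | right | by []]; apply: val_inj.
case: (ord2 i) => ->; case: (ord2 j) => ->;
  by rewrite ?M0 ?M1 /= ?mulr0 ?mulr1 ?addr0 ?add0r.
Qed.

Lemma zero_diag_triple (x y z : 'M[F]_2) :
  x \in zero_diag -> y \in zero_diag -> z \in zero_diag ->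
  x * y * z \in zero_diag.
Proof.
rewrite !unfold_in => /andP[/eqP x0 /eqP x1] /andP[/eqP y0 /eqP y1].
move=> /andP[/eqP z0 /eqP z1].
rewrite !mxE !big_ord_recl !big_ord0 !mxE !big_ord_recl !big_ord0 /=.
have -> : lift ord0 ord0 = 1 :> 'I_2 by apply: val_inj.
rewrite x0 x1 y0 y1 z0 z1.
by rewrite !(mul0r, mulr0, add0r, addr0) eqxx.
Qed.

Lemma zdmx_comb_is_linear (V : lmodType F) (u v : V) :
  linear (fun x : zdmx => (x : 'M_2) 0 1 *: u + (x : 'M_2) 1 0 *: v).
Proof.
move=> c x y; have h i j : zdmx_val (c *: x + y) i j = c * x i j + y i j.
  by rewrite -[zdmx_val _]/(c *: zdmx_val x + zdmx_val y) !mxE.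
by rewrite !h !scalerDl scalerDr !scalerA addrACA.
Qed.

Definition phi (x : zdmx) : free2 F :=
  (x : 'M_2) 0 1 *: gen_a F + (x : 'M_2) 1 0 *: gen_b F.

Fact phi_is_linear : linear phi.
Proof. exact: zdmx_comb_is_linear. Qed.

HB.instance Definition _ :=
  GRing.isLinear.Build F zdmx (free2 F) *:%R phi phi_is_linear.

Lemma phi_e1 : phi e1 = gen_a F.
Proof.
rewrite /phi; move: (gen_a F) (gen_b F) => u v.
by rewrite !mxE /= scale1r scale0r addr0.
Qed.

Lemma phi_e2 : phi e2 = gen_b F.
Proof.
rewrite /phi; move: (gen_a F) (gen_b F) => u v.
by rewrite !mxE /= scale1r scale0r add0r.
Qed.

End ZeroDiag.

(* A trilinear operation is evaluated in every associative algebra, by one and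
   the same rational combination of the six products. *)
Definition rational_trilinear (F : fieldType)
    (f : forall B : algType F, B -> B -> B -> B) : Prop :=
  exists c1 c2 c3 c4 c5 c6 : rat, forall (B : algType F) (x y z : B),
    f B x y z =
      ratr c1 *: (x * y * z) + ratr c2 *: (x * z * y) +
      ratr c3 *: (y * x * z) + ratr c4 *: (y * z * x) +
      ratr c5 *: (z * x * y) + ratr c6 *: (z * y * x).

Record trilinear_op (F : fieldType) := TrilinearOp {
  tri_fun :> forall B : algType F, B -> B -> B -> B;
  tri_funP : rational_trilinear tri_fun
}.
Arguments tri_fun {F} t B x y z.

Definition lie_br (B : nzRingType) (u v : B) : B := u * v - v * u.
Definition jordan_prod (F : fieldType) (B : algType F) (u v : B) : B :=
  2%:R^-1 *: (u * v + v * u).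

Section Operations.
Variable F : fieldType.
Local Notation "u \o_J v" := (jordan_prod u v) (at level 40).

Let ratr0 : ratr 0 = 0 :> F.
Proof. by rewrite (ratr_nat F 0). Qed.
Let ratr1 : ratr 1 = 1 :> F.
Proof. by rewrite (ratr_nat F 1). Qed.
Let ratrN1 : ratr (-1) = -1 :> F.
Proof. by rewrite (ratr_int F (-1)). Qed.
Let ratrV2 : ratr (2%:R^-1) = 2%:R^-1 :> F.
Proof. by rewrite /ratr; have -> : numq 2%:R^-1 = 1 by []; rewrite mul1r. Qed.

Definition omega1_fun (B : algType F) (x y z : B) : B := x * lie_br y z.

Fact omega1P : rational_trilinear omega1_fun.
Proof.
exists 1, (-1), 0, 0, 0, 0 => B x y z.
rewrite ratr0 ratr1 ratrN1 !scale0r scale1r scaleN1r !addr0.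
by rewrite /omega1_fun /lie_br mulrBr !mulrA.
Qed.

Definition omega1 : trilinear_op F := TrilinearOp omega1P.

Definition omega2_fun (B : algType F) (x y z : B) : B :=
  x * (y \o_J z) + z * (x \o_J y) + (z \o_J x) * y.

Fact omega2P : rational_trilinear omega2_fun.
Proof.
have [F2|F2] := eqVneq (2%:R : F) 0.
  exists 0, 0, 0, 0, 0, 0 => B x y z.
  rewrite ratr0 !scale0r !addr0 /omega2_fun /jordan_prod F2 invr0 !scale0r.
  by rewrite !mulr0 mul0r !addr0.
exists 2%:R^-1, 1, 0, 0, 1, 2%:R^-1 => B x y z.
have h : ratr 1 = 2%:R^-1 + 2%:R^-1 :> F.
  by rewrite ratr1 -mulr2n -[RHS]mulr_natr mulVf.
rewrite ratr0 h ratrV2 !scale0r !addr0 !scalerDl.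
rewrite /omega2_fun /jordan_prod -!scalerAr -scalerAl !mulrDr mulrDl !mulrA.
by rewrite !scalerDr (AC ((2*2)*2) (1*(2*6)*(3*5)*4)).
Qed.

Definition omega2 : trilinear_op F := TrilinearOp omega2P.

Definition omega3_fun (B : algType F) (x y z : B) : B := x * y * z + z * y * x.

Fact omega3P : rational_trilinear omega3_fun.
Proof.
exists 1, 0, 0, 0, 0, 1 => B x y z.
by rewrite ratr0 ratr1 !scale0r !scale1r !addr0.
Qed.

Definition omega3 : trilinear_op F := TrilinearOp omega3P.

End Operations.

Section Envelope.
Variables (F : fieldType) (w : trilinear_op F).

Fact tri_zero_diag (x y z : zdmx F) :
  w 'M[F]_2 (zdmx_val x) (zdmx_val y) (zdmx_val z) \in @zero_diag F.
Proof.
have [c1 [c2 [c3 [c4 [c5 [c6 ->]]]]]] := tri_funP w.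
have hx := valP x; have hy := valP y; have hz := valP z.
by do !apply: rpredD; apply: rpredZ; apply: zero_diag_triple.
Qed.

(* The operation of the triple system A^omega; its carrier is [zdmx F]. *)
Definition triA (x y z : zdmx F) : zdmx F := ZDMx (tri_zero_diag x y z).

Definition env_rel (g : free2 F) : Prop :=
  exists x y z : zdmx F,
    [/\ x \in [:: e1 F; e2 F], y \in [:: e1 F; e2 F], z \in [:: e1 F; e2 F] &
        g = w (free2 F) (phi x) (phi y) (phi z) - phi (triA x y z)].

Definition env_ideal : free2 F -> bool := ideal_gen env_rel.

Fact comb_eq0 (B : algType F) (f : {lrmorphism B -> F | *%R}) (c d : F)
    (u v : B) :
  f u = 0 -> f v = 0 -> f (c *: u + d *: v) = 0.
Proof. by move=> u0 v0; rewrite raddfD /= !linearZ /= u0 v0 !mulr0 addr0. Qed.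

Fact tri_eq0 (B : algType F) (f : {lrmorphism B -> F | *%R}) (x y z : B) :
  f x = 0 -> f y = 0 -> f z = 0 -> f (w B x y z) = 0.
Proof.
have [c1 [c2 [c3 [c4 [c5 [c6 ->]]]]]] := tri_funP w.
move=> x0 y0 z0; rewrite !raddfD /= !linearZ /= !rmorphM /= x0 y0 z0.
by rewrite !mulr0 !addr0.
Qed.

Fact rmorph_ker_ideal (B : nzRingType) (f : {rmorphism B -> F}) :
  two_sided_ideal (fun u => f u = 0).
Proof.
split=> [|u v u0 v0|a u u0]; first by rewrite raddf0.
  by rewrite raddfB /= u0 v0 subr0.
by rewrite !rmorphM /= u0 mulr0 mul0r.
Qed.

(* The relators have no constant term, so the ideal is proper. *)
Fact env_rel_const g : env_rel g -> const_term g = 0.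
Proof.
have phi0 (x : zdmx F) : const_term (phi x) = 0.
  exact: (comb_eq0 _ _ (@const_term_a F) (@const_term_b F)).
move=> [x [y [z [_ _ _ ->]]]]; rewrite raddfB /= phi0 subr0.
by apply: tri_eq0; apply: phi0.
Qed.

Fact env_ideal_idealr : idealr_closed env_ideal.
Proof.
split.
- by apply/asboolP=> J [].
- apply/negP=> /asboolP /(_ (fun u => const_term u = 0)) h.
  suff : const_term (1 : free2 F) = 0.
    by rewrite rmorph1 => /eqP; rewrite oner_eq0.
  apply: h; last exact: env_rel_const.
  exact: (rmorph_ker_ideal (@const_term F)).
- move=> a u v /asboolP hu /asboolP hv; apply/asboolP=> J idJ GJ.
  have [J0 JB JM] := idJ.
  have JN t : J t -> J (- t) by rewrite -[- t]sub0r; apply: JB.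
  rewrite -[v]opprK; apply: JB; last by apply: JN; apply: hv.
  by have [] := JM a _ (hu J idJ GJ).
Qed.

Fact env_ideal_mulr : forall a, {in env_ideal, forall u, u * a \in env_ideal}.
Proof.
move=> a u /asboolP hu; apply/asboolP=> J idJ GJ.
by have [_ _ JM] := idJ; have [] := JM a _ (hu J idJ GJ).
Qed.

HB.instance Definition _ := isIdealr.Build (free2 F) env_ideal env_ideal_idealr.
HB.instance Definition _ := isRightIdeal.Build (free2 F) env_ideal env_ideal_mulr.

Definition univ_env : algType F := @alg_quot (free2 F) env_ideal.

End Envelope.

Definition alg_iso (F : fieldType) (A B : algType F) : Prop :=
  exists f : {lrmorphism A -> B}, bijective f.

(* Main.v *)
From HB Require Import structures.
Require Import Defs.
From mathcomp Require Import all_boot all_algebra.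
From mathcomp Require Import boolp.

Set Implicit Arguments.
Unset Strict Implicit.
Unset Printing Implicit Defensive.

Import GRing.Theory.
Local Open Scope ring_scope.
Local Open Scope quotient_scope.

(* In characteristic 0 each of the three operations forces the generators of its
   envelope to satisfy the matrix unit relations a^2 = b^2 = 0, aba = a and
   bab = b. Conversely these relations make phi multiplicative on associative
   triple products, hence compatible with every trilinear operation. So the
   three ideals of the free algebra coincide. *)

(** * Matrix unit relations *)

Definition matrix_units (R : nzRingType) (a b : R) : Prop :=
  [/\ a * a = 0, b * b = 0, a * b * a = a & b * a * b = b].

(** Every word of length three other than [aba] and [bab] contains [aa] or [bb]. The result is a
    multiplication table used as one rewrite rule. *)
Lemma matrix_units_triple (R : nzRingType) (a b : R) : matrix_units a b ->
  (a * a * a = 0) * (a * a * b = 0) * (a * b * a = a) * (a * b * b = 0) *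
  (b * a * a = 0) * (b * a * b = b) * (b * b * a = 0) * (b * b * b = 0).
Proof.
case=> aa bb aba bab; do !split=> //; rewrite ?aa ?bb ?mul0r //;
  by rewrite -mulrA ?aa ?bb mulr0.
Qed.

(** Exchanging [a] and [b] swaps the two halves of the matrix unit relations, so for a symmetric
    hypothesis one half is enough. *)
Lemma matrix_units_sym (R : nzRingType) (P : R -> R -> Prop) :
  (forall a b, P a b -> P b a) ->
  (forall a b, P a b -> a * a = 0 /\ a * b * a = a) ->
  forall a b, P a b -> matrix_units a b.
Proof.
move=> symP h a b Pab; have [aa aba] := h _ _ Pab.
by have [bb bab] := h _ _ (symP _ _ Pab).
Qed.

(** * Quotient algebras by ideals with the same elements *)

Section AlgQuotientMorphism.
Variables (F : fieldType) (B : algType F).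

Definition pi_alg (I : ideal2 B) (x : B) : alg_quot I := \pi_(alg_quot I) x.

Fact pi_alg_is_zmod_morphism I : zmod_morphism (pi_alg I).
Proof. by move=> x y; rewrite /pi_alg raddfB. Qed.
Fact pi_alg_is_monoid_morphism I : monoid_morphism (pi_alg I).
Proof. by split=> // x y; rewrite /pi_alg -pi_alg_mul. Qed.
Fact pi_alg_is_scalable I : scalable (pi_alg I).
Proof. by move=> c x; rewrite /pi_alg -pi_alg_scale. Qed.

HB.instance Definition _ I := GRing.isZmodMorphism.Build B (alg_quot I)
  (pi_alg I) (pi_alg_is_zmod_morphism I).
HB.instance Definition _ I := GRing.isMonoidMorphism.Build B (alg_quot I)
  (pi_alg I) (pi_alg_is_monoid_morphism I).
HB.instance Definition _ I := GRing.isScalable.Build F B (alg_quot I) *:%R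
  (pi_alg I) (pi_alg_is_scalable I).

Section Transport.
Variables (I J : ideal2 B).
Hypothesis IJ : (I : pred B) =i (J : pred B).

(* The unused argument lets instance resolution recover the equality [IJ]. *)
Definition quot_transport of (I : pred B) =i (J : pred B) :=
  fun x : alg_quot I => pi_alg J (repr x).
Local Notation transport := (quot_transport IJ).

(** The chosen representative of the class of [x] differs from [x] by an element of [I], hence of
    [J], so the choice does not matter. *)
Lemma quot_transportE x : transport (pi_alg I x) = pi_alg J x.
Proof.
by apply/pi_alg_quotP; rewrite -IJ; apply/pi_alg_quotP; rewrite reprK.
Qed.

Fact quot_transport_is_zmod_morphism : zmod_morphism transport.
Proof.
elim/alg_quotW=> x; elim/alg_quotW=> y.
by rewrite -!/(pi_alg I _) -raddfB !quot_transportE raddfB.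
Qed.
Fact quot_transport_is_monoid_morphism : monoid_morphism transport.
Proof.
split; first by rewrite -(rmorph1 (pi_alg I)) quot_transportE rmorph1.
elim/alg_quotW=> x; elim/alg_quotW=> y.
by rewrite -!/(pi_alg I _) -rmorphM !quot_transportE rmorphM.
Qed.
Fact quot_transport_is_scalable : scalable transport.
Proof.
move=> c; elim/alg_quotW=> x.
by rewrite -!/(pi_alg I _) -linearZ !quot_transportE linearZ.
Qed.

HB.instance Definition _ := GRing.isZmodMorphism.Build (alg_quot I) (alg_quot J)
  transport quot_transport_is_zmod_morphism.
HB.instance Definition _ := GRing.isMonoidMorphism.Build (alg_quot I)
  (alg_quot J) transport quot_transport_is_monoid_morphism.
HB.instance Definition _ := GRing.isScalable.Build F (alg_quot I) (alg_quot J)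
  *:%R transport quot_transport_is_scalable.

End Transport.

Lemma quot_transportK (I J : ideal2 B) (IJ : (I : pred B) =i (J : pred B))
    (JI : (J : pred B) =i (I : pred B)) :
  cancel (quot_transport IJ) (quot_transport JI).
Proof.
by move=> y; elim/alg_quotW: y => x; rewrite -/(pi_alg _ _) !quot_transportE.
Qed.

Lemma alg_iso_quot (I J : ideal2 B) :
  (I : pred B) =i (J : pred B) -> alg_iso (alg_quot I) (alg_quot J).
Proof.
move=> IJ; have JI : (J : pred B) =i (I : pred B) by move=> x; rewrite IJ.
exists (quot_transport IJ : {lrmorphism alg_quot I -> alg_quot J}).
by exists (quot_transport JI); apply: quot_transportK.
Qed.

End AlgQuotientMorphism.

(** * Triple representations in associative algebras *)

Section TripleRepresentation.
Variable F : fieldType.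

(** The coefficients of [w] are the same in every algebra, and algebra morphisms preserve each of
    the six products. *)
Lemma tri_lrmorph (w : trilinear_op F) (B C : algType F)
    (f : {lrmorphism B -> C}) x y z : f (w B x y z) = w C (f x) (f y) (f z).
Proof.
have [c1 [c2 [c3 [c4 [c5 [c6 h]]]]]] := tri_funP w.
by rewrite !h !raddfD /= !linearZ /= !rmorphM.
Qed.

(** The map [phi] with arbitrary images of the generators, extended to all matrices by ignoring the
    diagonal so that it applies directly to matrix products. *)
Definition offdiag (V : lmodType F) (a b : V) (M : 'M[F]_2) : V :=
  M 0 1 *: a + M 1 0 *: b.

Fact offdiag_is_linear V a b : linear (@offdiag V a b).
Proof.
by move=> c M N; rewrite /offdiag !mxE !scalerDl scalerDr !scalerA addrACA.
Qed.
HB.instance Definition _ (V : lmodType F) (a b : V) :=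
  GRing.isLinear.Build F 'M[F]_2 V *:%R
  (offdiag a b) (@offdiag_is_linear V a b).

Lemma linear_offdiag (V W : lmodType F) (f : {linear V -> W}) (a b : V) M :
  f (offdiag a b M) = offdiag (f a) (f b) M.
Proof. by rewrite /offdiag raddfD /= !linearZ. Qed.

(** The defining relations of [univ_env w], imposed on a pair of elements of [B] standing for the
    generators. *)
Definition triple_rep (w : trilinear_op F) (B : algType F) (a b : B) : Prop :=
  forall x y z : zdmx F,
    x \in [:: e1 F; e2 F] -> y \in [:: e1 F; e2 F] -> z \in [:: e1 F; e2 F] ->
    w B (offdiag a b x) (offdiag a b y) (offdiag a b z) =
      offdiag a b (w 'M[F]_2 (zdmx_val x) (zdmx_val y) (zdmx_val z)).

Lemma matrix_units_e : matrix_units (zdmx_val (e1 F)) (zdmx_val (e2 F)).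
Proof. by split; rewrite /= -!mulmxE !(mul_delta_mx_cond, mulr1n, mulr0n). Qed.

Lemma e1_in : e1 F \in [:: e1 F; e2 F].
Proof. by rewrite !inE eqxx. Qed.
Lemma e2_in : e2 F \in [:: e1 F; e2 F].
Proof. by rewrite !inE eqxx orbT. Qed.

Section Offdiag.
Variables (V : lmodType F) (a b : V).

Lemma offdiag_e1 : offdiag a b (e1 F) = a.
Proof. by rewrite /offdiag !mxE /= scale1r scale0r addr0. Qed.
Lemma offdiag_e2 : offdiag a b (e2 F) = b.
Proof. by rewrite /offdiag !mxE /= scale1r scale0r add0r. Qed.

End Offdiag.

(** The pairs [e1], [e2] and [a], [b] both satisfy the matrix unit relations, so their triple
    products follow the same table. *)
Lemma offdiag_triple (B : algType F) (a b : B) (x y z : zdmx F) :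
  matrix_units a b ->
  x \in [:: e1 F; e2 F] -> y \in [:: e1 F; e2 F] -> z \in [:: e1 F; e2 F] ->
  offdiag a b (zdmx_val x * zdmx_val y * zdmx_val z) =
  offdiag a b x * offdiag a b y * offdiag a b z.
Proof.
move=> /matrix_units_triple mu; have EE := matrix_units_triple matrix_units_e.
rewrite !inE => /orP[]/eqP-> /orP[]/eqP-> /orP[]/eqP->;
  by rewrite EE ?raddf0 !(offdiag_e1, offdiag_e2) mu.
Qed.

Lemma matrix_units_triple_rep (w : trilinear_op F) (B : algType F) (a b : B) :
  matrix_units a b -> triple_rep w a b.
Proof.
move=> mu x y z hx hy hz; have [c1 [c2 [c3 [c4 [c5 [c6 h]]]]]] := tri_funP w.
by rewrite !h !raddfD /= !linearZ /= !offdiag_triple.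
Qed.

(** * Relators of the envelope and ideals of the free algebra *)

Section EnvelopeRep.
Variable w : trilinear_op F.

Lemma pi_phi (I : ideal2 (free2 F)) (x : zdmx F) :
  pi_alg I (phi x) =
  offdiag (pi_alg I (gen_a F)) (pi_alg I (gen_b F)) (zdmx_val x).
Proof. exact: (linear_offdiag (pi_alg I) (gen_a F) (gen_b F)). Qed.

Lemma env_rel_in_ideal (I : ideal2 (free2 F)) (x y z : zdmx F) :
  w (free2 F) (phi x) (phi y) (phi z) - phi (triA w x y z)
    \in (I : pred (free2 F)) <->
  w (alg_quot I)
    (offdiag (pi_alg I (gen_a F)) (pi_alg I (gen_b F)) (zdmx_val x))
    (offdiag (pi_alg I (gen_a F)) (pi_alg I (gen_b F)) (zdmx_val y))
    (offdiag (pi_alg I (gen_a F)) (pi_alg I (gen_b F)) (zdmx_val z)) =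
  offdiag (pi_alg I (gen_a F)) (pi_alg I (gen_b F))
    (w 'M[F]_2 (zdmx_val x) (zdmx_val y) (zdmx_val z)).
Proof.
rewrite -(pi_alg_quotP I) -!/(pi_alg I _).
set l := pi_alg I _; set r := pi_alg I _; set l' := w _ _ _ _.
set r' := offdiag _ _ _.
have -> : l = l'.
  apply: etrans (tri_lrmorph w (pi_alg I) (phi x) (phi y) (phi z)) _.
  by congr (tri_fun w _ _ _ _); apply: pi_phi.
by have -> : r = r' by apply: pi_phi.
Qed.

(** Turns ideal membership into equations between the two generator classes in the quotient, where
    the matrix unit computations take place. *)
Lemma env_rel_sub_triple_rep (I : ideal2 (free2 F)) :
  (forall g, env_rel w g -> g \in (I : pred (free2 F))) <->
  triple_rep w (pi_alg I (gen_a F)) (pi_alg I (gen_b F)).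
Proof.
split=> [h x y z hx hy hz | h _ [x [y [z [hx hy hz ->]]]]].
  by apply/env_rel_in_ideal/h; exists x, y, z.
exact/env_rel_in_ideal/h.
Qed.

Lemma env_ideal_min (I : ideal2 (free2 F)) :
  (forall g, env_rel w g -> g \in (I : pred (free2 F))) ->
  {subset (env_ideal w : pred (free2 F)) <= (I : pred (free2 F))}.
Proof.
move=> hI x /asboolP /(_ (fun u => u \in (I : pred _))); apply=> //.
split=> [|u v|c u]; [exact: rpred0 | exact: rpredB |].
by split; [apply: ideal2Ml | apply: ideal2Mr].
Qed.

Lemma env_rel_in g : env_rel w g -> g \in (env_ideal w : pred (free2 F)).
Proof. by move=> hg; apply/asboolP=> J _; apply. Qed.

End EnvelopeRep.

(** In the quotient by the ideal of one operation the generators are matrix units, hence satisfy the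
    relations of the other operation as well. Each ideal therefore contains the other. *)
Lemma alg_iso_env (w1 w2 : trilinear_op F) :
  (forall (B : algType F) (a b : B), triple_rep w1 a b -> matrix_units a b) ->
  (forall (B : algType F) (a b : B), triple_rep w2 a b -> matrix_units a b) ->
  alg_iso (univ_env w1) (univ_env w2).
Proof.
move=> h1 h2; apply: alg_iso_quot => x.
have sub (w w' : trilinear_op F) :
    (forall (B : algType F) (a b : B), triple_rep w' a b -> matrix_units a b) ->
    {subset (env_ideal w : pred (free2 F)) <= (env_ideal w' : pred (free2 F))}.
  move=> h; apply: env_ideal_min; apply/env_rel_sub_triple_rep.
  by apply/matrix_units_triple_rep/h/env_rel_sub_triple_rep/env_rel_in.
by apply/idP/idP; apply: sub.
Qed.

End TripleRepresentation.

(** * Matrix unit relations from the three operations *)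

Section Omegas.
Variables (F : fieldType) (charF0 : [pchar F] =i pred0).

Lemma char0_mulrIn (V : lmodType F) n (u v : V) :
  u *+ n.+1 = v *+ n.+1 -> u = v.
Proof.
have n0 : n.+1%:R != 0 :> F by rewrite ((pcharf0P F).1 charF0).
by rewrite -!(scaler_nat n.+1) => /(scalerI n0).
Qed.

Lemma char0_mulrn_eq0 (V : lmodType F) n (u : V) : u *+ n.+1 = 0 -> u = 0.
Proof. by move=> h; apply: (@char0_mulrIn _ n); rewrite mul0rn. Qed.

Lemma omega1_matrix_units (B : algType F) (a b : B) :
  triple_rep (omega1 F) a b -> matrix_units a b.
Proof.
move=> h; have EE := matrix_units_triple (matrix_units_e F).
(* These are the relations at [(e1, e1, e2)] and [(e2, e2, e1)]; no other triples are used. *)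
pose P (a b : B) := a * (a * b - b * a) = - a /\ b * (b * a - a * b) = - b.
apply: (@matrix_units_sym _ P) => [? ? []|{h}{}a {}b [ha hb]|] //; last first.
  have E1 : zdmx_val (e1 F) * (zdmx_val (e1 F) * e2 F - zdmx_val (e2 F) * e1 F)
      = - zdmx_val (e1 F) by rewrite mulrBr !mulrA !EE sub0r.
  have E2 : zdmx_val (e2 F) * (zdmx_val (e2 F) * e1 F - zdmx_val (e1 F) * e2 F)
      = - zdmx_val (e2 F) by rewrite mulrBr !mulrA !EE sub0r.
  split.
    move: (h _ _ _ (e1_in F) (e1_in F) (e2_in F)).
    by rewrite /= /omega1_fun /lie_br E1 raddfN /= offdiag_e1 offdiag_e2.
  move: (h _ _ _ (e2_in F) (e2_in F) (e1_in F)).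
  by rewrite /= /omega1_fun /lie_br E2 raddfN /= offdiag_e1 offdiag_e2.
(* The commutator c satisfies ac = -a and bc = b, so c^2 = ab + ba; expanding
   a c^2 = a and comparing with ac = -a yields aab = 0 and aba = a. *)
pose c := a * b - b * a; rewrite -/c in ha.
have hbc : b * c = b by rewrite -[RHS]opprK -hb -mulrN opprB.
have hcc : c * c = a * b + b * a.
  by rewrite {1}/c mulrBl -!mulrA hbc ha mulrN opprK.
have hp : a * a * b + a * b * a = a.
  by rewrite -!mulrA -mulrDr -hcc mulrA ha mulNr ha opprK.
have hm : a * a * b - a * b * a = - a by rewrite -!mulrA -mulrBr.
have aab : a * a * b = 0.
  apply: (@char0_mulrn_eq0 _ 1); move: (congr2 +%R hp hm).
  by rewrite addrACA !subrr addr0.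
have aba : a * b * a = a by rewrite -[RHS]hp aab add0r.
(* Here [aa = a(aba) = (aab)a = 0]. *)
by split=> //; rewrite -{2}aba !mulrA aab mul0r.
Qed.

Lemma halfD (V : lmodType F) (u : V) : 2%:R^-1 *: (u + u) = u.
Proof.
have two0 : 2%:R != 0 :> F by rewrite ((pcharf0P F).1 charF0).
by rewrite -mulr2n -scaler_nat scalerA mulVf ?scale1r.
Qed.

Lemma omega2E (B : algType F) (x y z : B) : @omega2_fun F B x y z =
  2%:R^-1 *: (x * y * z + z * y * x) + (x * z * y + z * x * y).
Proof.
rewrite -[X in _ + X]halfD -scalerDr /omega2_fun /jordan_prod.
rewrite -!scalerAr -scalerAl -!scalerDr !mulrDr mulrDl !mulrA; congr (_ *: _).
by rewrite (AC ((2*2)*2) ((1*4)*((2*3)*(6*5)))).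
Qed.

Lemma omega2_matrix_units (B : algType F) (a b : B) :
  triple_rep (omega2 F) a b -> matrix_units a b.
Proof.
move=> h; have EE := matrix_units_triple (matrix_units_e F).
(* The relations at [(e1, e1, e1)], [(e1, e2, e1)] and [(e1, e1, e2)], the first one divided by
   3. *)
pose Q (a b : B) := [/\ a * a * a = 0, a * b * a + (a * a * b) *+ 2 = a &
  2%:R^-1 *: (a * a * b + b * a * a) + (a * b * a + b * a * a) = a].
apply: (@matrix_units_sym _ (fun a b => Q a b /\ Q b a)).
- by move=> ? ? [].
- move=> {h}{}a {}b [[aaa h1 h2] _].
  (* Twice the third relation minus twice the second leaves [3 baa = 3 aab]. *)
  have comm : a * a * b = b * a * a.
    have h3 : (a * a * b + b * a * a) + (a * b * a + b * a * a) *+ 2 = a *+ 2.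
      rewrite -[in RHS]h2 [RHS]mulrnDl; congr (_ + _).
      by rewrite scalerMnr mulr2n halfD.
    apply/esym/(@char0_mulrIn _ 2); move: h3.
    rewrite -[X in _ = X *+ 2]h1 !mulrnDl -(mulrnDr _ 2 2) addrCA => /addrI.
    by rewrite -addrA -mulrS (mulrS _ 3) => /addrI.
  (* Multiplying the second relation by [a] on the left gives [aa = aaba + 2 aaab]. The last term
     vanishes by [aaa = 0], and [aaba = baaa = 0] by [comm]. *)
  have aa : a * a = 0.
    rewrite -{2}h1 mulrDr mulrnAr !mulrA aaa mul0r mul0rn addr0.
    by rewrite comm -2!mulrA (mulrA a a a) aaa mulr0.
  by split=> //; rewrite -[RHS]h1 aa mul0r mul0rn addr0.
split; split.
- move: (h _ _ _ (e1_in F) (e1_in F) (e1_in F)).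
  rewrite offdiag_e1 /= !omega2E !EE addr0 scaler0 addr0 raddf0 halfD.
  by rewrite -mulr2n -mulrS; apply: char0_mulrn_eq0.
- move: (h _ _ _ (e1_in F) (e2_in F) (e1_in F)).
  rewrite offdiag_e1 offdiag_e2 /= !omega2E !halfD !EE !addr0 offdiag_e1.
  by rewrite -mulr2n.
- move: (h _ _ _ (e1_in F) (e1_in F) (e2_in F)).
  rewrite offdiag_e1 offdiag_e2 /= !omega2E !EE !addr0 scaler0 add0r.
  by rewrite offdiag_e1.
- move: (h _ _ _ (e2_in F) (e2_in F) (e2_in F)).
  rewrite offdiag_e2 /= !omega2E !EE addr0 scaler0 addr0 raddf0 halfD.
  by rewrite -mulr2n -mulrS; apply: char0_mulrn_eq0.
- move: (h _ _ _ (e2_in F) (e1_in F) (e2_in F)).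
  rewrite offdiag_e1 offdiag_e2 /= !omega2E !halfD !EE !addr0 offdiag_e2.
  by rewrite -mulr2n.
- move: (h _ _ _ (e2_in F) (e2_in F) (e1_in F)).
  rewrite offdiag_e1 offdiag_e2 /= !omega2E !EE !addr0 scaler0 add0r.
  by rewrite offdiag_e2.
Qed.

Lemma omega3_matrix_units (B : algType F) (a b : B) :
  triple_rep (omega3 F) a b -> matrix_units a b.
Proof.
move=> h; have EE := matrix_units_triple (matrix_units_e F).
(* The relations at [(e1, e1, e1)], [(e1, e1, e2)] and [(e1, e2, e1)], the first and the last
   divided by 2. *)
pose Q (a b : B) :=
  [/\ a * a * a = 0, a * a * b + b * a * a = 0 & a * b * a = a].
apply: (@matrix_units_sym _ (fun a b => Q a b /\ Q b a)).
- by move=> ? ? [].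
- move=> {h}{}a {}b [[aaa aab aba] _]; split=> //.
  (* The product expands to [a(aba) + b(aaa)], which is [aa]. *)
  have: (a * a * b + b * a * a) * a = 0 by rewrite aab mul0r.
  by rewrite mulrDl -!mulrA (mulrA a a a) aaa mulr0 addr0 (mulrA a b a) aba.
split; split.
- move: (h _ _ _ (e1_in F) (e1_in F) (e1_in F)).
  rewrite offdiag_e1 /= /omega3_fun !EE addr0 raddf0 -mulr2n.
  exact: char0_mulrn_eq0.
- move: (h _ _ _ (e1_in F) (e1_in F) (e2_in F)).
  rewrite offdiag_e1 offdiag_e2 /= /omega3_fun !EE.
  by rewrite addr0 raddf0.
- move: (h _ _ _ (e1_in F) (e2_in F) (e1_in F)).
  rewrite offdiag_e1 offdiag_e2 /= /omega3_fun !EE raddfD /=.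
  by rewrite offdiag_e1 -!mulr2n; apply: char0_mulrIn.
- move: (h _ _ _ (e2_in F) (e2_in F) (e2_in F)).
  rewrite offdiag_e2 /= /omega3_fun !EE addr0 raddf0 -mulr2n.
  exact: char0_mulrn_eq0.
- move: (h _ _ _ (e2_in F) (e2_in F) (e1_in F)).
  rewrite offdiag_e1 offdiag_e2 /= /omega3_fun !EE.
  by rewrite addr0 raddf0.
- move: (h _ _ _ (e2_in F) (e1_in F) (e2_in F)).
  rewrite offdiag_e1 offdiag_e2 /= /omega3_fun !EE raddfD /=.
  by rewrite offdiag_e2 -!mulr2n; apply: char0_mulrIn.
Qed.

End Omegas.

Theorem theorem5p5 (F : fieldType) (charF0 : [pchar F] =i pred0) :
  alg_iso (univ_env (omega1 F)) (univ_env (omega2 F)) /\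
  alg_iso (univ_env (omega2 F)) (univ_env (omega3 F)).
Proof.
by split; apply: alg_iso_env => B a b; [exact: omega1_matrix_units |
  exact: omega2_matrix_units | exact: omega2_matrix_units |
  exact: omega3_matrix_units].
Qed.
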